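(* In the setting described in the context: (i) The finite discrete Heun equation $\tilde a_{\textsc{m}-k}h_{k+1}+a_kh_{k-1}+b_kh_k=\textsc{e}\,h_k$ ($k=0,\dots,\textsc{m}$; the terms with $h_{-1}$, $h_{\textsc{m}+1}$ carry zero coefficients $a_0=\tilde a_0=0$) for a vector $(h_0,\dots,h_{\textsc{m}})\in\mathbb{C}^{\textsc{m}+1}$ possesses nontrivial solutions only for $\textsc{e}\in\{\textsc{e}_0,\dots,\textsc{e}_{\textsc{m}}\}$, where $\textsc{e}_0>\textsc{e}_1>\cdots>\textsc{e}_{\textsc{m}}$ are the roots of $p_{\textsc{m}+1}$. (ii) For $\textsc{e}=\textsc{e}_j$ a solution is given by $h_k(\textsc{e}_j)=h_0(\textsc{e}_j)\,p_k(\textsc{e}_j)\prod_{0\le i<k}\tilde a_{\textsc{m}-i}^{-1}$ ($k=0,\dots,\textsc{m}$), with $h_0(\textsc{e}_j)=|\epsilon_j|^{1/2}=\big|\tilde a_1\cdots\tilde a_{\textsc{m}}/p_{\textsc{m}}(\textsc{e}_j)\big|^{1/2}$. (iii) Palindromic quasi-symmetry: $\tilde{\textsc{e}}_j=\textsc{e}_j$ and $\tilde h_k(\tilde{\textsc{e}}_j)=(-1)^j h_{\textsc{m}-k}(\textsc{e}_j)$ for all $j,k=0,\dots,\textsc{m}$. (iv) For $0\le i,j\le\textsc{m}$, $$\sum_{k=0}^{\textsc{m}}h_k(\textsc{e}_i)h_k(\textsc{e}_j)\prod_{1\le n\le k}\tilde a_{\textsc{m}+1-n}\prod_{k+1\le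 n\le\textsc{m}}a_n=\begin{cases}\prod_{0\le l\le\textsc{m},\,l\ne j}|\textsc{e}_j-\textsc{e}_l|&i=j,\\0&i\ne j,\end{cases}$$ and for $0\le l,k\le\textsc{m}$, $$\sum_{j=0}^{\textsc{m}}\frac{h_l(\textsc{e}_j)h_k(\textsc{e}_j)}{\prod_{0\le i\le\textsc{m},\,i\ne j}|\textsc{e}_j-\textsc{e}_i|}=\begin{cases}\Big(\prod_{1\le n\le k}\tilde a_{\textsc{m}+1-n}\prod_{k+1\le n\le\textsc{m}}a_n\Big)^{-1}&l=k,\\0&l\ne k.\end{cases}$$
   Context: Fix $0<p<1$ and the Jacobi theta functions $\theta_1(z)=2p^{1/4}\sin z\prod_{n\ge1}(1-p^{2n})(1-2p^{2n}\cos 2z+p^{4n})$, $\theta_2(z)=2p^{1/4}\cos z\prod_{n\ge1}(1-p^{2n})(1+2p^{2n}\cos 2z+p^{4n})$, $\theta_3(z)=\prod_{n\ge1}(1-p^{2n})(1+2p^{2n-1}\cos 2z+p^{4n-2})$, $\theta_4(z)=\prod_{n\ge1}(1-p^{2n})(1-2p^{2n-1}\cos 2z+p^{4n-2})$. For $\alpha>0$ set $[z]_1=\theta_1(\frac{\alpha}{2}z)/(\frac{\alpha}{2}\theta_1'(0))$, $[z]_r=\theta_r(\frac{\alpha}{2}z)/\theta_r(0)$ ($r=2,3,4$). Parameters: real $u_1,\dots,u_4,v_1,\dots,v_4$ with $u_r>0$, $|v_r|<u_r+\frac12$ for $r=1,2$; $\textsc{m}\in\mathbb{N}$; $\alpha=\pi/(u_1+u_2+\textsc{m})$;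 a real $u$ with $u,u+1\notin\frac{2\pi}{\alpha}\mathbb{Z}$. Let $\pi_1=\mathrm{id}$, $\pi_2=(12)(34)$, $\pi_3=(13)(24)$, $\pi_4=(14)(23)$ in $S_4$, and $c_r=\frac{2}{[u]_1[u+1]_1}\prod_{s=1}^4[u_{\pi_r(s)}-\frac12]_s[v_{\pi_r(s)}]_s$. For integers $k$ define $a_k=\prod_{r=1}^4\frac{[u_1-u_r+k]_r[u_1-v_r-\frac12+k]_r}{[u_1+k]_r[u_1-\frac12+k]_r}$, $\tilde a_k=\prod_{r=1}^4\frac{[u_2-u_{\pi_2(r)}+k]_r[u_2-v_{\pi_2(r)}-\frac12+k]_r}{[u_2+k]_r[u_2-\frac12+k]_r}$, $b_k=\sum_{r=1}^4c_r\frac{[u_1+k+\frac12+u]_r[u_1+k-\frac12-u]_r}{[u_1+k+\frac12]_r[u_1+k-\frac12]_r}$ (so $a_0=\tilde a_0=0$). Let $\mathbf H$ be the $(\textsc{m}+1)\times(\textsc{m}+1)$ tridiagonal matrix with rows/columns indexed by $0,\dots,\textsc{m}$, $H_{k,k}=b_k$, $H_{k,k-1}=a_k$ ($1\le k\le\textsc{m}$), $H_{k,k+1}=\tilde a_{\textsc{m}-k}$ ($0\le k\le\textsc{m}-1$), all other entries $0$. The monic elliptic Racah polynomials are $p_0(\textsc{e})=1$ and, for $1\le k\le\textsc{m}+1$, $p_k(\textsc{e})$ = the determinant of the upper-left $k\times k$ submatrix of $\textsc{e}\mathbf I_{\textsc{m}+1}-\mathbf H$. For any quantity $X$ depending on the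 parameters, $\tilde X$ denotes the same quantity with $(u_1,v_1)\leftrightarrow(u_2,v_2)$ and $(u_3,v_3)\leftrightarrow(u_4,v_4)$ interchanged (e.g. $\tilde{\textsc{e}}_j$, $\tilde p_k$, $\tilde h_k$). $\epsilon_j=\tilde p_{\textsc{m}}(\textsc{e}_j)/(a_1\cdots a_{\textsc{m}})$. *)

(* Defs.v *)
From HB Require Import structures.
From mathcomp Require Import all_boot all_order all_algebra.
From mathcomp Require Import all_classical all_reals all_analysis.
From mathcomp Require Import complex.

Set Implicit Arguments.
Unset Strict Implicit.
Unset Printing Implicit Defensive.

Import Order.TTheory GRing.Theory Num.Theory.
Import numFieldNormedType.Exports.
Local Open Scope ring_scope.

Section Defs.
Variable R : realType.

Definition infprod (f : nat -> R) : R :=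
  limn (fun N : nat => \prod_(1 <= n < N.+1) f n).

Definition theta1 (p z : R) : R :=
  2 * p `^ (4^-1) * sin z *
  infprod (fun n => (1 - p ^+ (2 * n)) *
                    (1 - 2 * p ^+ (2 * n) * cos (2 * z) + p ^+ (4 * n))).
Definition theta2 (p z : R) : R :=
  2 * p `^ (4^-1) * cos z *
  infprod (fun n => (1 - p ^+ (2 * n)) *
                    (1 + 2 * p ^+ (2 * n) * cos (2 * z) + p ^+ (4 * n))).
Definition theta3 (p z : R) : R :=
  infprod (fun n => (1 - p ^+ (2 * n)) *
                    (1 + 2 * p ^+ (2 * n - 1) * cos (2 * z) + p ^+ (4 * n - 2))).
Definition theta4 (p z : R) : R :=
  infprod (fun n => (1 - p ^+ (2 * n)) *
                    (1 - 2 * p ^+ (2 * n - 1) * cos (2 * z) + p ^+ (4 * n - 2))).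

(* [z]_r ; the index r : 'I_4 stands for r+1 (so ord0 is [.]_1) *)
Definition br (p alpha : R) (r : 'I_4) (z : R) : R :=
  match val r with
  | 0 => theta1 p (alpha / 2 * z) / (alpha / 2 * derive1 (theta1 p) 0)
  | 1 => theta2 p (alpha / 2 * z) / theta2 p 0
  | 2 => theta3 p (alpha / 2 * z) / theta3 p 0
  | _ => theta4 p (alpha / 2 * z) / theta4 p 0
  end.

Definition alpha_of (u : 'I_4 -> R) (M : nat) : R :=
  pi / (u ord0 + u (inord 1) + M%:R).

(* the permutations pi_1 = id, pi_2 = (12)(34), pi_3 = (13)(24), pi_4 = (14)(23),
   acting on 'I_4 = {0,1,2,3} standing for {1,2,3,4}; pi r s = pi_{r+1}(s+1) - 1 *)
Definition piperm (r s : 'I_4) : 'I_4 :=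
  match val r with
  | 0 => s
  | 1 => inord (match val s with 0 => 1 | 1 => 0 | 2 => 3 | _ => 2 end)
  | 2 => inord (match val s with 0 => 2 | 1 => 3 | 2 => 0 | _ => 1 end)
  | _ => inord (match val s with 0 => 3 | 1 => 2 | 2 => 1 | _ => 0 end)
  end.

(* the "tilde" operation: (u1,v1)<->(u2,v2), (u3,v3)<->(u4,v4), i.e. precompose
   with pi_2 *)
Definition tildeP (w : 'I_4 -> R) : 'I_4 -> R := fun s => w (piperm (inord 1) s).

Section Params.
Variables (p : R) (u v : 'I_4 -> R) (M : nat) (uu : R).

Let alpha := alpha_of u M.
Let b := br p alpha.

Definition c_coef (r : 'I_4) : R :=
  2 / (b ord0 uu * b ord0 (uu + 1)) *
  \prod_(s < 4) (b s (u (piperm r s) - 2^-1) * b s (v (piperm r s))).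

Definition a_coef (k : nat) : R :=
  \prod_(r < 4)
    (b r (u ord0 - u r + k%:R) * b r (u ord0 - v r - 2^-1 + k%:R) /
     (b r (u ord0 + k%:R) * b r (u ord0 - 2^-1 + k%:R))).

Definition b_coef (k : nat) : R :=
  \sum_(r < 4) c_coef r *
    (b r (u ord0 + k%:R + 2^-1 + uu) * b r (u ord0 + k%:R - 2^-1 - uu) /
     (b r (u ord0 + k%:R + 2^-1) * b r (u ord0 + k%:R - 2^-1))).

End Params.

Section Params2.
Variables (p : R) (u v : 'I_4 -> R) (M : nat) (uu : R).

(* \tilde a_k ; note alpha_of (tildeP u) M = alpha_of u M *)
Definition at_coef (k : nat) : R := a_coef p (tildeP u) (tildeP v) M k.

Definition Hmat : 'M[R]_(M.+1) :=
  \matrix_(i, j)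
    (if i == j then b_coef p u v M uu i
     else if (i : nat) == j.+1 then a_coef p u v M i
     else if (j : nat) == i.+1 then at_coef (M - i)
     else 0).

Definition pk (k : nat) : {poly R} :=
  \det (\matrix_(i < k, j < k)
          (('X%:M - map_mx polyC Hmat) (inord i) (inord j) : {poly R})).

End Params2.

Section Params3.
Variables (p : R) (u v : 'I_4 -> R) (M : nat) (uu : R).

Definition pkt (k : nat) : {poly R} := pk p (tildeP u) (tildeP v) M uu k.

Definition eps (E : R) : R :=
  (pkt M).[E] / \prod_(1 <= n < M.+1) a_coef p u v M n.

Definition hk (k : nat) (E : R) : R :=
  Num.sqrt `|eps E| * (pk p u v M uu k).[E] *
  \prod_(0 <= i < k) (at_coef p u v M (M - i))^-1.

Definition wk (k : nat) : R :=
  \prod_(1 <= n < k.+1) at_coef p u v M (M.+1 - n) *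
  \prod_(k.+1 <= n < M.+1) a_coef p u v M n.

End Params3.

End Defs.

(* Main.v *)
Require Import Defs.
From HB Require Import structures.
From mathcomp Require Import all_boot all_order all_algebra.
From mathcomp Require Import all_classical all_reals all_analysis.
From mathcomp Require Import complex.
From mathcomp Require Import polyrcf perm ring lra zify.
Import Order.TTheory GRing.Theory Num.Theory.
Import numFieldNormedType.Exports.
Local Open Scope ring_scope.

(** The sign of each bracket is that of a sine or a cosine, because the infinite
products are positive; the parameter conditions then make every a_k and every
tilde a_k with 1 <= k <= m positive, so H is a Jacobi matrix and the p_k satisfy a
three-term recurrence with positive coefficients.  Reality and simplicity of the
spectrum follow from the interlacing of the roots of p_k and p_(k+1), and
orthogonality from the Christoffel-Darboux formula.  The quarter-period shift
z |-> pi/alpha - z exchanges the brackets 1 <-> 2 and 3 <-> 4 up to constant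
factors, whence tilde b_k = b_(m-k): the tilde matrix is H with rows and columns
reversed.  Since eigenspaces of a Jacobi matrix are lines, reversing an
eigenvector of H yields a multiple of the corresponding tilde eigenvector; the
factor epsilon_j = (tilde a_1 ... tilde a_m) / p_m(e_j) has sign (-1)^j by
interlacing. *)

(** * Determinants *)

(** Rows and columns are permuted by the same permutation, so its sign enters squared. *)
Lemma det_ord_rev {S : comNzRingType} n (A : 'M[S]_n) :
  \det (\matrix_(i < n, j < n) A (rev_ord i) (rev_ord j)) = \det A.
Proof.
pose s := perm (@rev_ord_inj n).
have -> : \matrix_(i < n, j < n) A (rev_ord i) (rev_ord j) = row_perm s (col_perm s A).
  by apply/matrixP => i j; rewrite !mxE !permE.
by rewrite row_permE col_permE !det_mulmx !det_perm odd_permV mulrCA -expr2 sqrr_sign mulr1.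
Qed.

(** The last row has two entries. In the minor of the off-diagonal one the last column has a single
    entry left, so a second expansion reaches the minor of size [k]. *)
Lemma det_tridiag {S : comNzRingType} (f : nat -> nat -> S) k :
  (forall i j, (i.+1 < j)%N || (j.+1 < i)%N -> f i j = 0) ->
  \det (\matrix_(i < k.+2, j < k.+2) f i j) =
  f k.+1 k.+1 * \det (\matrix_(i < k.+1, j < k.+1) f i j)
  - f k.+1 k * f k k.+1 * \det (\matrix_(i < k, j < k) f i j).
Proof.
move=> f0.
rewrite (expand_det_row _ ord_max) big_ord_recr big_ord_recr /= big1 ?add0r; last first.
  by move=> i _; rewrite !mxE /= f0 ?mul0r //; apply/orP; right; rewrite !ltnS.
rewrite !mxE /= addrC; congr (_ * _ + _).
  rewrite /cofactor -signr_odd oddD addbb expr0 mul1r; congr (\det _).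
  apply/matrixP => i j; rewrite !mxE /=; congr f; rewrite /bump leqNgt ?ltn_ord //;
  by rewrite ltnS ltnW ?ltn_ord.
rewrite -mulrA -mulrN; congr (_ * _).
rewrite /cofactor /= -signr_odd addSn /= oddD addbb expr1 mulN1r; congr (- _).
rewrite (expand_det_col _ ord_max) big_ord_recr /= big1 ?add0r; last first.
  move=> i _; rewrite !mxE /= f0 ?mul0r //.
  by have := ltn_ord i; rewrite /bump; lia.
rewrite !mxE /= {1}/bump ltnn add0n {1}/bump leqnn add1n; congr (_ * _).
rewrite /cofactor -signr_odd oddD addbb expr0 mul1r; congr (\det _).
have bump_lt h m : (m < h)%N -> bump h m = m by move=> mh; rewrite /bump leqNgt mh.
apply/matrixP => i j; rewrite !mxE /= !(bump_lt k) ?ltn_ord //.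
by rewrite !(bump_lt k.+1) //; apply: ltnW; apply: ltn_ord.
Qed.

(** * Interlacing of the roots of orthogonal polynomials *)

Lemma sign_prod_subr {R : realDomainType} (x : R) (y : nat -> R) n i :
  (i <= n)%N -> (forall l, (l < i)%N -> x < y l) ->
  (forall l, (i <= l < n)%N -> y l < x) ->
  0 < (-1) ^+ i * \prod_(l < n) (x - y l).
Proof.
elim: n i => [|n IH] i.
  by rewrite leqn0 => /eqP -> _ _; rewrite big_ord0 expr0 mulr1.
rewrite leq_eqVlt => /predU1P[-> lt_xy _|le_in lt_xy lt_yx]; rewrite big_ord_recr /=.
  rewrite exprS mulN1r mulNr -mulrN -mulrN opprB mulrA.
  rewrite mulr_gt0 ?subr_gt0 ?lt_xy //.
  apply: IH => // [l ln|l]; first by apply: lt_xy; apply: ltnW.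
  by rewrite ltnNge andbN.
rewrite mulrA mulr_gt0 ?subr_gt0 ?lt_yx ?leqnn ?andbT //.
by apply: IH => // l /andP[il ln]; apply: lt_yx; rewrite il ltnW.
Qed.

(** The intermediate value theorem on each gap between consecutive points; beyond [n] the chosen
    value is an arbitrary 0. *)
Lemma alternating_roots {R : rcfType} (Q : {poly R}) (Y : nat -> R) n :
  (forall i, (i < n)%N -> Y i.+1 < Y i) ->
  (forall i, (i <= n)%N -> 0 < (-1) ^+ i * Q.[Y i]) ->
  exists z : nat -> R, forall i, (i < n)%N ->
    [/\ Y i.+1 < z i, z i < Y i & root Q (z i)].
Proof.
move=> Ydec Ysgn.
suff /choice[z zP] : forall i, exists z, (i < n)%N ->
    [/\ Y i.+1 < z, z < Y i & root Q z] by exists z.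
move=> i; case: (ltnP i n) => [lt_in|_]; last by exists 0.
have [|z] := @poly_ivtoo _ Q (Y i.+1) (Y i) (ltW (Ydec i lt_in)).
  have := mulr_gt0 (Ysgn _ (ltnW lt_in)) (Ysgn _ lt_in).
  rewrite mulrACA -exprD addnS exprS -signr_odd oddD addbb mulr1 mulN1r.
  by rewrite oppr_gt0 mulrC.
by rewrite in_itv /= => /andP[? ?] ?; exists z.
Qed.

Lemma monic_sign_far {R : realFieldType} (Q : {poly R}) n c :
  Q \is monic -> size Q = n.+1 ->
  exists a b : R, [/\ a < c, c < b, 0 < Q.[b] & 0 < (-1) ^+ n * Q.[a]].
Proof.
move=> Qm Qs.
have [b hb] : exists b, forall x, b <= x -> 0 < Q.[x].
  have lc : 0 < lead_coef Q by rewrite (monicP Qm).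
  have [b hb] := poly_pinfty_gt_lc lc.
  by exists b => x /hb; apply: lt_le_trans.
(* This reflection again has leading coefficient 1, so its positivity near plus infinity is the sign
   of [Q] near minus infinity. *)
pose Q' := (-1) ^+ n *: (Q \Po (- 'X)).
have [a ha] : exists a, forall x, a <= x -> 0 < Q'.[x].
  have lc : 0 < lead_coef Q'.
    rewrite /Q' lead_coefZ lead_coef_comp ?size_polyN ?size_polyX //.
    by rewrite (monicP Qm) mul1r lead_coefN lead_coefX Qs /= -exprD -signr_odd oddD addbb.
  have [a ha] := poly_pinfty_gt_lc lc.
  by exists a => x /ha; apply: lt_le_trans.
exists (- Num.max a (1 - c)), (Num.max b (c + 1)); split.
- by rewrite ltrNl lt_max; apply/orP; right; lra.
- by rewrite lt_max; apply/orP; right; lra.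
- by apply: hb; rewrite le_max lexx.
- have := ha (Num.max a (1 - c)); rewrite le_max lexx => /(_ isT).
  by rewrite /Q' hornerZ horner_comp hornerN hornerX.
Qed.

(* At [k = 0] the predecessor [k.-1] is [0] again; the
    junk term [P k.-1] is then killed by [l 0 = 0]. *)
Section ThreeTerm.
Variables (R : rcfType) (M : nat) (b l : nat -> R) (P : nat -> {poly R}).
Hypotheses (P0 : P 0%N = 1) (l0 : l 0%N = 0)
  (PS : forall k, (k <= M)%N ->
     P k.+1 = ('X - (b k)%:P) * P k - l k *: P k.-1).

Lemma three_term_monic k : (k <= M.+1)%N -> P k \is monic /\ size (P k) = k.+1.
Proof.
elim/ltn_ind: k => -[|k] IH; first by rewrite P0 monic1 size_poly1.
rewrite ltnS => le_kM; rewrite PS //.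
have [mk sk] := IH k (ltnSn k) (leqW le_kM).
have s1 : size (('X - (b k)%:P) * P k) = k.+2.
  by rewrite size_Mmonic ?polyXsubC_eq0 // size_XsubC sk.
have s2 : (size (- (l k *: P k.-1)) < size (('X - (b k)%:P) * P k)%R)%N.
  rewrite size_polyN s1; apply: leq_ltn_trans (size_scale_leq _ _) _.
  have [_ ->] := IH k.-1 (leq_ltn_trans (leq_pred k) (ltnSn k))
    (leq_trans (leq_pred k) (leqW le_kM)).
  by rewrite !ltnS leq_pred.
split; last by rewrite size_polyDl.
by rewrite monicE lead_coefDl // lead_coefM lead_coefXsubC mul1r (monicP mk).
Qed.

Hypothesis l_gt0 : forall k, (0 < k <= M)%N -> 0 < l k.

(** The sign condition encodes interlacing and carries the induction: at a root of [P k.+1] the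
    recurrence reduces to [P k.+2 = - l k.+1 * P k], so [P k.+2] alternates along these roots, and
    its signs far out supply the two outer changes. *)
Lemma three_term_roots k : (k <= M)%N ->
  exists y : nat -> R,
    [/\ forall i j, (i < j <= k)%N -> y j < y i,
        P k.+1 = \prod_(i < k.+1) ('X - (y i)%:P) &
        forall i, (i <= k)%N -> 0 < (-1) ^+ i * (P k).[y i]].
Proof.
elim: k => [_|k IH lt_kM].
  exists (fun=> b 0%N); split.
  - by move=> i j; rewrite leqn0 => /andP[ij /eqP j0]; rewrite j0 in ij.
  - by rewrite PS // P0 l0 scale0r subr0 mulr1 big_ord_recr big_ord0 /= mul1r.
  - by move=> i; rewrite leqn0 => /eqP ->; rewrite P0 hornerC mulr1 ltr01.
have [y [ydec Py ysgn]] := IH (ltnW lt_kM).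
have [mQ sQ] := @three_term_monic k.+2 lt_kM.
have [lo [_ [lo_lt _ _ Qlo]]] := monic_sign_far _ _ (y k) mQ sQ.
have [_ [hi [_ hi_gt Qhi _]]] := monic_sign_far _ _ (y 0%N) mQ sQ.
(* The k+3 test points in decreasing order: [hi], the k+1 roots of [P k.+1], then [lo]. *)
pose Y i := if i is i'.+1 then (if (i' <= k)%N then y i' else lo) else hi.
have Ydec i : (i < k.+2)%N -> Y i.+1 < Y i.
  rewrite /Y; case: i => [|i]; first by rewrite leq0n.
  rewrite !ltnS leq_eqVlt => /predU1P[->|ik]; first by rewrite ltnn eqxx.
  by rewrite ik orbT ydec // ltnSn ik.
have Ysgn i : (i <= k.+2)%N -> 0 < (-1) ^+ i * (P k.+2).[Y i].
  rewrite /Y; case: i => [|i]; first by rewrite expr0 mul1r.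
  rewrite ltnS leq_eqVlt => /predU1P[->|ik]; first by rewrite ltnn.
  rewrite -ltnS ik PS // hornerD hornerM hornerN hornerZ /=.
  have -> : (P k.+1).[y i] = 0.
    by apply/eqP; rewrite Py horner_prod (bigD1 (Ordinal ik)) //= hornerXsubC subrr mul0r.
  rewrite mulr0 add0r exprS mulN1r mulrNN mulrCA mulr_gt0 ?ysgn //.
  by apply: l_gt0; rewrite ltnS leq0n.
have [z zP] := alternating_roots _ _ _ Ydec Ysgn.
have zdec i j : (i < j <= k.+1)%N -> z j < z i.
  elim: j => // j IHj /andP[]; rewrite ltnS leq_eqVlt => /predU1P[->|ij] jk.
    have [_ zj _] := zP j.+1 jk; have [zj' _ _] := zP j (ltnW jk).
    exact: lt_trans zj zj'.
  have [_ zj _] := zP j.+1 jk; have [zj' _ _] := zP j (ltnW jk).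
  apply: lt_trans (lt_trans zj zj') _; apply: IHj; rewrite ij; exact: ltnW.
have yY i : (i <= k)%N -> y i = Y i.+1 by move=> ik; rewrite /Y ik.
have Yanti i j : (i <= j <= k.+2)%N -> Y j <= Y i.
  elim: j => [|j IHj] /andP[]; first by rewrite leqn0 => /eqP ->.
  rewrite leq_eqVlt => /predU1P[->//|ij jk].
  by apply: le_trans (ltW (Ydec j jk)) _; apply: IHj; rewrite -ltnS ij ltnW.
exists z; split => //.
(* The k+2 distinct roots exhaust the degree. *)
- have -> : P k.+2 = lead_coef (P k.+2) *: \prod_(x <- [seq z i | i <- iota 0 k.+2]) ('X - x%:P).
    apply: all_roots_prod_XsubC.
    + by rewrite size_map size_iota.
    + by rewrite all_map; apply/allP => i; rewrite mem_iota /= => ik; case: (zP i ik).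
    + rewrite uniq_rootsE map_inj_in_uniq ?iota_uniq // => i j.
      rewrite !mem_iota /= !ltnS => ik jk zij.
      by case: (ltngtP i j) => // ij; [have := zdec i j | have := zdec j i];
         rewrite ij ?ik ?jk zij ltxx => /(_ isT).
  rewrite (monicP mQ) scale1r big_map -[iota _ _]/(index_iota 0 k.+2) big_mkord //.
(* Exactly the roots [y 0, ..., y (i-1)] lie above [z i], which gives the sign of the product. *)
- move=> i ik; have [z1 z2 _] := zP i ik.
  rewrite Py horner_prod; under eq_bigr do rewrite hornerXsubC.
  apply: sign_prod_subr => // j.
    move=> ji; rewrite yY ?(leq_trans ji) //; last by lia.
    by apply: lt_le_trans z2 _; apply: Yanti; rewrite ji; lia.
  move=> /andP[ij jk]; rewrite yY //; apply: le_lt_trans z1.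
  by apply: Yanti; rewrite ltnS ij; lia.
Qed.

End ThreeTerm.

(** * Eigenvectors of Jacobi matrices *)

(** Orthogonality of the rows says that [A] has the right inverse [B]. For square matrices it is
    also a left inverse, and the entries of [B *m A] are the dual relations. *)
Lemma dual_orthogonality {F : fieldType} n (h : 'I_n -> 'I_n -> F) (w N : 'I_n -> F) :
  (forall k, w k != 0) -> (forall j, N j != 0) ->
  (forall i j, \sum_k h i k * h j k * w k = if i == j then N j else 0) ->
  forall l k, \sum_j h j l * h j k / N j = if l == k then (w k)^-1 else 0.
Proof.
move=> w0 N0 orth l k.
pose A := \matrix_(i, k) h i k; pose B := \matrix_(k, j) (w k * h j k / N j).
have AB : A *m B = 1%:M.
  apply/matrixP => i j; rewrite !mxE.
  transitivity ((\sum_k h i k * h j k * w k) / N j).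
    by rewrite mulr_suml; apply: eq_bigr => m _; rewrite !mxE; ring.
  by rewrite orth; case: eqP => _; rewrite ?mul0r // divff.
have /matrixP /(_ k l) := mulmx1C AB; rewrite !mxE => BA.
apply: (mulfI (w0 k)); rewrite mulr_sumr.
transitivity (\sum_j B k j * A j l); first by apply: eq_bigr => j _; rewrite !mxE; ring.
by rewrite BA eq_sym; case: eqP => _; rewrite ?mulr0 // divff.
Qed.

(** The library's [eigenvalue] concerns row vectors, hence the passage to the transpose. *)
Lemma eigenvector_root_char {F : fieldType} n (A : 'M[F]_n) (h : 'cV[F]_n) e :
  A *m h = e *: h -> h != 0 -> root (char_poly A) e.
Proof.
move=> Ah h0; have -> : char_poly A = char_poly A^T.
  rewrite /char_poly -det_tr; congr (\det _); apply/matrixP => i j.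
  by rewrite !mxE eq_sym.
rewrite -eigenvalue_root_char; apply/eigenvalueP; exists h^T.
  by rewrite -trmx_mul Ah linearZ.
by rewrite -trmx0 (inj_eq trmx_inj).
Qed.

Section ChristoffelDarboux.
Variables (F : fieldType) (M : nat) (b l : nat -> F) (P : nat -> {poly F}).
Hypotheses (P0 : P 0%N = 1) (l0 : l 0%N = 0)
  (PS : forall k, (k <= M)%N ->
     P k.+1 = ('X - (b k)%:P) * P k - l k *: P k.-1)
  (l_neq0 : forall k, (0 < k <= M)%N -> l k != 0).

Lemma prod_l_neq0 k : (k <= M)%N -> \prod_(1 <= n < k.+1) l n != 0.
Proof.
move=> kM; rewrite prodf_seq_neq0; apply/allP => n; rewrite mem_index_iota /=.
by move=> /andP[n0 nk]; apply: l_neq0; rewrite n0 (leq_trans _ kM).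
Qed.

(** Induction on [k]: inserting the recurrence for [P k.+2] into the numerator cancels the [b]
    terms, and the [l] terms reproduce the previous numerator. *)
Lemma Christoffel_Darboux (x y : F) k : (k <= M)%N ->
  (x - y) * \sum_(i < k.+1) (P i).[x] * (P i).[y] / \prod_(1 <= n < i.+1) l n =
  ((P k.+1).[x] * (P k).[y] - (P k).[x] * (P k.+1).[y]) / \prod_(1 <= n < k.+1) l n.
Proof.
elim: k => [_|k IH kM].
  rewrite big_ord_recr big_ord0 /= big_geq // PS // P0 l0 !hornerE /= invr1; ring.
have L0 := prod_l_neq0 k (ltnW kM).
have lk : l k.+1 != 0 by apply: l_neq0; rewrite kM.
rewrite big_ord_recr mulrDr IH ?(ltnW kM) //= (big_nat_recr k.+1) //= (PS k.+1) //=
  !(hornerD, hornerN, hornerM, hornerZ, hornerX, hornerC).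
move: L0 lk; move: (\prod_(1 <= n < k.+1) l n) (l k.+1) => L m L0 m0.
move: (P k).[x] (P k).[y] (P k.+1).[x] (P k.+1).[y] => p0 q0 p1 q1.
by field; rewrite m0.
Qed.

(** The limit y -> x of the preceding identity, obtained by the same induction with the
    differentiated recurrence. *)
Lemma Christoffel_Darboux_confluent (x : F) k : (k <= M)%N ->
  \sum_(i < k.+1) (P i).[x] ^+ 2 / \prod_(1 <= n < i.+1) l n =
  ((P k.+1)^`().[x] * (P k).[x] - (P k)^`().[x] * (P k.+1).[x])
    / \prod_(1 <= n < k.+1) l n.
Proof.
elim: k => [_|k IH kM].
  by rewrite big_ord_recr big_ord0 /= big_geq // PS // P0 l0 scale0r subr0 mulr1
    derivXsubC derivC !hornerC; ring.
have L0 := prod_l_neq0 k (ltnW kM).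
have lk : l k.+1 != 0 by apply: l_neq0; rewrite kM.
rewrite big_ord_recr IH ?(ltnW kM) //= (big_nat_recr k.+1) //= (PS k.+1) //=.
rewrite derivB derivM derivZ derivXsubC.
rewrite !(hornerD, hornerN, hornerM, hornerZ, hornerX, hornerC).
move: L0 lk; move: (\prod_(1 <= n < k.+1) l n) (l k.+1) => L m L0 m0.
move: (P k).[x] (P k)^`().[x] (P k.+1).[x] (P k.+1)^`().[x] => p0 q0 p1 q1.
by field; rewrite m0.
Qed.

End ChristoffelDarboux.

Section Jacobi.
Variables (F : fieldType) (M : nat) (b a t : nat -> F) (P : nat -> {poly F}).
Hypotheses (P0 : P 0%N = 1) (a0 : a 0%N = 0) (t0 : t 0%N = 0)
  (PS : forall k, (k <= M)%N ->
     P k.+1 = ('X - (b k)%:P) * P k - (a k * t (M.+1 - k)%N) *: P k.-1)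
  (t_neq0 : forall k, (0 < k <= M)%N -> t k != 0).

(** The candidate eigenvector for [x], normalised to have entry 1 at index 0. *)
Definition jac_vec x k : F := (P k).[x] * \prod_(0 <= i < k) (t (M - i)%N)^-1.

(** Each row is the recurrence of the [P k], rescaled. Only the last row requires [x] to be a root
    of [P M.+1]. *)
Lemma jac_vecP x k : (k <= M)%N -> root (P M.+1) x || (k < M)%N ->
  t (M - k)%N * jac_vec x k.+1 + a k * jac_vec x k.-1 + b k * jac_vec x k = x * jac_vec x k.
Proof.
move=> kM kP; pose G := \prod_(0 <= i < k) (t (M - i)%N)^-1.
have -> : t (M - k)%N * jac_vec x k.+1 = (P k.+1).[x] * G.
  rewrite /jac_vec big_nat_recr //=.
  (* For [k = M] the entry of index M+1 contains the inverse of [t 0 = 0]; the factor [t 0] in front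
     removes this default value. *)
  have [kEM|ltkM] := eqVneq k M.
    by move: kP; rewrite kEM ltnn orbF subnn t0 mul0r => /rootP ->; rewrite mul0r.
  by rewrite mulrCA [t _ * _]mulrCA mulfV ?mulr1 // t_neq0 //; lia.
have -> : a k * jac_vec x k.-1 = a k * t (M.+1 - k)%N * (P k.-1).[x] * G.
  rewrite /G /jac_vec; case: k {G} kM kP => [|k] kM _; first by rewrite a0 !mul0r.
  rewrite big_nat_recr //= subSS -!mulrA; congr (_ * _).
  rewrite [RHS]mulrCA; congr (_ * _).
  by rewrite mulrCA mulfV ?mulr1 // t_neq0 //; lia.
by rewrite PS // /jac_vec -/G !(hornerD, hornerN, hornerM, hornerZ, hornerX, hornerC); ring.
Qed.

(** Since [t (M - k)] is nonzero, row [k] determines entry [k.+1] from the earlier ones: eigenspaces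
    are at most lines. *)
Lemma jac_vec_uniq x (f : nat -> F) :
  (forall k, (k < M)%N ->
     t (M - k)%N * f k.+1 + a k * f k.-1 + b k * f k = x * f k) ->
  forall k, (k <= M)%N -> f k = f 0%N * jac_vec x k.
Proof.
move=> fP; elim/ltn_ind => -[_ _|k IH kM].
  by rewrite /jac_vec big_geq // P0 hornerC !mulr1.
have tk : t (M - k)%N != 0 by apply: t_neq0; lia.
apply: (mulfI tk).
have kM' := ltnW kM.
have k1 : (k.-1 < k.+1)%N by rewrite ltnS leq_pred.
have := fP k kM; rewrite (IH k) // (IH k.-1) ?(leq_trans (leq_pred k)) //.
have := jac_vecP x k kM'; rewrite kM orbT => /(_ isT) jP.
move=> fk.
transitivity (x * (f 0%N * jac_vec x k) - a k * (f 0%N * jac_vec x k.-1)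
  - b k * (f 0%N * jac_vec x k)); first by rewrite -fk; ring.
by rewrite mulrCA -jP; ring.
Qed.

End Jacobi.

(** Has the shape of [Hmat] for arbitrary sequences, so that the two agree by conversion. *)
Definition jacobi_mx {F : nmodType} M (b a t : nat -> F) : 'M[F]_M.+1 :=
  \matrix_(i, j)
    (if i == j then b i
     else if (i : nat) == j.+1 then a i
     else if (j : nat) == i.+1 then t (M - i)%N
     else 0).

Lemma jacobi_mx_mulE {F : pzRingType} M (b a t f : nat -> F) (i : 'I_M.+1) :
  a 0%N = 0 -> t 0%N = 0 ->
  (jacobi_mx M b a t *m \col_(k < M.+1) f k) i 0 =
  t (M - i)%N * f i.+1 + a i * f i.-1 + b i * f i.
Proof.
move=> a0 t0; rewrite mxE.
(* At [i = 0] the indices [i.-1] and [i] coincide; the spurious term is killed by [a 0 = 0].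
   Likewise [t 0 = 0] removes [f M.+1]. *)
transitivity (\sum_(j < M.+1) ((if (j : nat) == i.+1 then t (M - i)%N * f j else 0)
   + (if ((j : nat) == i.-1) then a i * f j else 0)
   + (if (j : nat) == i then b i * f j else 0))).
  apply: eq_bigr => j _; rewrite !mxE -!(inj_eq val_inj) /= eq_sym.
  case: (eqVneq (j : nat) i) => [->|ji].
    rewrite ltn_eqF // add0r; case: (eqVneq (i : nat) i.-1) => [E|]; last by rewrite add0r.
    by have -> : (i : nat) = 0%N by [lia]; rewrite a0 mul0r add0r.
  case: (eqVneq (i : nat) j.+1) => [->|ij] /=; last first.
    have -> : (if (j : nat) == i.-1 then a i * f j else 0) = 0.
      by case: eqP => // jE; have -> : (i : nat) = 0%N by [lia]; rewrite a0 mul0r.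
    by rewrite !addr0; case: ifP; rewrite ?mul0r.
  by rewrite eqxx (ltn_eqF (ltn_trans (ltnSn j) (ltnSn _))) add0r addr0.
have sum_delta m (c : nat -> F) :
    \sum_(j < M.+1) (if (j : nat) == m then c j else 0) = if (m < M.+1)%N then c m else 0.
  by rewrite -big_mkcond big_ord1_eq.
rewrite !big_split /= (sum_delta _ (fun j => t (M - i)%N * f j)).
rewrite (sum_delta _ (fun j => a i * f j)) (sum_delta _ (fun j => b i * f j)) ltnS.
rewrite (ltn_ord i) (leq_ltn_trans (leq_pred i) (ltn_ord i)).
by case: ltnP => // Mi; have -> : (M - i = 0)%N by [lia]; rewrite t0 mul0r.
Qed.

Lemma deriv_prod_XsubC_root {R : comNzRingType} n (y : nat -> R) (j : 'I_n) :
  (\prod_(i < n) ('X - (y i)%:P))^`().[y j] = \prod_(i < n | i != j) (y j - y i).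
Proof.
rewrite (bigD1 j) //= derivM derivXsubC mul1r hornerD hornerM hornerXsubC subrr mul0r addr0.
by rewrite horner_prod; apply: eq_bigr => i _; rewrite hornerXsubC.
Qed.

(** * A Jacobi matrix and its reversal: endpoint entries, norms and spectrum *)

Section JacobiPair.
Variables (R : rcfType) (M : nat) (b a t : nat -> R) (P Q : nat -> {poly R}).
Hypotheses (a0 : a 0%N = 0) (t0 : t 0%N = 0)
  (a_gt0 : forall k, (0 < k <= M)%N -> 0 < a k)
  (t_gt0 : forall k, (0 < k <= M)%N -> 0 < t k)
  (P0 : P 0%N = 1) (Q0 : Q 0%N = 1)
  (PS : forall k, (k <= M)%N ->
     P k.+1 = ('X - (b k)%:P) * P k - (a k * t (M.+1 - k)%N) *: P k.-1)
  (QS : forall k, (k <= M)%N ->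
     Q k.+1 = ('X - (b (M - k)%N)%:P) * Q k - (t k * a (M.+1 - k)%N) *: Q k.-1)
  (PQ : P M.+1 = Q M.+1).

Let a_neq0 k : (0 < k <= M)%N -> a k != 0.
Proof. by move=> /a_gt0 /lt0r_neq0. Qed.
Let t_neq0 k : (0 < k <= M)%N -> t k != 0.
Proof. by move=> /t_gt0 /lt0r_neq0. Qed.

(** [v] belongs to the matrix itself, [vt] to the reversed one, where [a] and [t] change places. *)
Let v := jac_vec _ M t P.
Let vt := jac_vec _ M a Q.

Lemma prod_inv_rev (c : nat -> R) :
  \prod_(0 <= i < M) (c (M - i)%N)^-1 = (\prod_(1 <= n < M.+1) c n)^-1.
Proof.
rewrite big_nat_rev add0n big_add1 /= -prodfV; apply: eq_big_nat => i /andP[_ iM].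
by congr (c _)^-1; lia.
Qed.

(** The reversed [vt] solves the rows of the original matrix, so by uniqueness it is [v] times its
    own entry at index 0, which is [vt x M]. *)
Lemma jac_vec_reversal x k : root (P M.+1) x -> (k <= M)%N ->
  vt x (M - k)%N = vt x M * v x k.
Proof.
move=> rx kM.
have rec j : (j < M)%N ->
    t (M - j)%N * vt x (M - j.+1)%N + a j * vt x (M - j.-1)%N + b j * vt x (M - j)%N
    = x * vt x (M - j)%N.
  move=> jM; rewrite /vt -(jac_vecP _ _ (fun k => b (M - k)%N) t a Q t0 a0 QS a_neq0);
    rewrite -?PQ ?rx ?leq_subr //.
  rewrite subKn ?(ltnW jM) // addrC [in RHS]addrC; congr (_ + _); rewrite addrC; congr (_ + _).
    case: j jM => [|j] jM; first by rewrite a0 !mul0r.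
    by congr (_ * jac_vec _ _ _ _ _ _); lia.
  by congr (_ * jac_vec _ _ _ _ _ _); lia.
have := jac_vec_uniq _ _ b a t P P0 a0 t0 PS t_neq0 x (fun k => vt x (M - k)%N) rec k kM.
by rewrite subn0.
Qed.

Lemma jac_vec_tilde_last x : vt x M = (Q M).[x] / \prod_(1 <= n < M.+1) a n.
Proof. by rewrite /vt /jac_vec prod_inv_rev. Qed.

Lemma jac_vec_last x : v x M = (P M).[x] / \prod_(1 <= n < M.+1) t n.
Proof. by rewrite /v /jac_vec prod_inv_rev. Qed.

(** The reversal identity at index [M], where [vt x 0 = 1]. *)
Lemma jac_vec_endpoints x : root (P M.+1) x -> vt x M * v x M = 1.
Proof.
move=> rx; rewrite -jac_vec_reversal // subnn /vt /jac_vec Q0 hornerC.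
by rewrite big_geq // mulr1.
Qed.

Lemma jac_vec_tilde_reversal x k : root (P M.+1) x -> (k <= M)%N ->
  vt x k = vt x M * v x (M - k)%N.
Proof. by move=> rx kM; rewrite -jac_vec_reversal ?leq_subr // subKn. Qed.

Let l k := a k * t (M.+1 - k)%N.
Let l_gt0 k : (0 < k <= M)%N -> 0 < l k.
Proof. by move=> kM; rewrite mulr_gt0 ?a_gt0 ?t_gt0 //; lia. Qed.
Let l_neq0 k : (0 < k <= M)%N -> l k != 0.
Proof. by move=> /l_gt0 /lt0r_neq0. Qed.
Let l0 : l 0%N = 0. Proof. by rewrite /l a0 mul0r. Qed.

Definition jac_weight k : R :=
  \prod_(1 <= n < k.+1) t (M.+1 - n)%N * \prod_(k.+1 <= n < M.+1) a n.

Lemma jac_weight_gt0 k : (k <= M)%N -> 0 < jac_weight k.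
Proof.
move=> kM; rewrite mulr_gt0 //; rewrite big_nat_cond; apply: prodr_gt0 => i.
  by rewrite andbT => /andP[i1 ik]; apply: t_gt0; lia.
by rewrite andbT => /andP[i1 ik]; apply: a_gt0; lia.
Qed.

(** One of the two inverse products of [t] cancels against the weight; completing the tail product
    of [a] leaves the summand of Christoffel-Darboux times a constant. *)
Lemma jac_vec_weight x y k : (k <= M)%N ->
  v x k * v y k * jac_weight k =
  (\prod_(1 <= n < M.+1) a n) * ((P k).[x] * (P k).[y] / \prod_(1 <= n < k.+1) l n).
Proof.
move=> kM; rewrite /v /jac_vec /jac_weight /l big_split /=.
rewrite [\prod_(1 <= n < M.+1) a n](big_cat_nat (ltn0Sn k)) ?ltnS //=.
have -> : \prod_(0 <= i < k) (t (M - i)%N)^-1 = (\prod_(1 <= i < k.+1) t (M.+1 - i)%N)^-1.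
  by rewrite big_add1 prodfV; congr _^-1; apply: eq_big_nat => i _; rewrite subSS.
have A0 : \prod_(1 <= n < k.+1) a n != 0.
  rewrite prodf_seq_neq0; apply/allP => n; rewrite mem_index_iota /= => nk.
  by apply: a_neq0; lia.
have T0 : \prod_(1 <= n < k.+1) t (M.+1 - n)%N != 0.
  rewrite prodf_seq_neq0; apply/allP => n; rewrite mem_index_iota /= => nk.
  by apply: t_neq0; lia.
move: A0 T0; move: (\prod_(1 <= n < k.+1) a n) (\prod_(1 <= n < k.+1) t _) => A T A0 T0.
move: (P k).[x] (P k).[y] (\prod_(k.+1 <= i < M.+1) a i) => p q B.
by field; rewrite T0.
Qed.

Lemma jac_vec_orthogonal x y : root (P M.+1) x -> root (P M.+1) y -> x != y ->
  \sum_(k < M.+1) v x k * v y k * jac_weight k = 0.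
Proof.
move=> /rootP rx /rootP ry xy.
under eq_bigr => k _ do rewrite jac_vec_weight -1?ltnS //.
rewrite -mulr_sumr.
suff -> : \sum_(i < M.+1) (P i).[x] * (P i).[y] / \prod_(1 <= n < i.+1) l n = 0 by rewrite mulr0.
have := Christoffel_Darboux _ _ _ _ _ P0 l0 PS l_neq0 x y M (leqnn M).
rewrite rx ry mul0r mulr0 subr0 mul0r => /eqP.
by rewrite mulf_eq0 subr_eq0 (negbTE xy) => /eqP.
Qed.

(** At a root only the derivative term of the confluent formula survives, and the endpoint identity
    absorbs its factor [(P M).[x]]. *)
Lemma jac_vec_norm x : root (P M.+1) x ->
  `|vt x M| * \sum_(k < M.+1) v x k * v x k * jac_weight k = `|(P M.+1)^`().[x]|.
Proof.
move=> rx; have S_ge0 : 0 <= \sum_(k < M.+1) v x k * v x k * jac_weight k.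
  apply: sumr_ge0 => k _; rewrite mulr_ge0 -?expr2 ?sqr_ge0 // ltW //.
  by rewrite jac_weight_gt0 -1?ltnS.
rewrite -[\sum_k _](ger0_norm S_ge0) -normrM; congr `|_|.
have := Christoffel_Darboux_confluent _ _ _ _ _ P0 l0 PS l_neq0 x M (leqnn M).
rewrite (rootP rx) mulr0 subr0 => CD.
under eq_bigr => k _ do rewrite jac_vec_weight -1?ltnS // -expr2.
rewrite -mulr_sumr CD.
have -> : \prod_(1 <= n < M.+1) l n =
    (\prod_(1 <= n < M.+1) a n) * \prod_(1 <= n < M.+1) t n.
  rewrite big_split /=; congr (_ * _).
  by rewrite big_nat_rev; apply: eq_big_nat => i iM; congr t; lia.
have := jac_vec_endpoints x rx; rewrite jac_vec_last.
have A0 : \prod_(1 <= n < M.+1) a n != 0.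
  by rewrite prodf_seq_neq0; apply/allP => n; rewrite mem_index_iota; apply: a_neq0.
have T0 : \prod_(1 <= n < M.+1) t n != 0.
  by rewrite prodf_seq_neq0; apply/allP => n; rewrite mem_index_iota; apply: t_neq0.
move: A0 T0; move: (\prod_(1 <= n < M.+1) a n) (\prod_(1 <= n < M.+1) t _) => A T A0 T0.
move: (P M).[x] (P M.+1)^`().[x] => p d e1.
transitivity (d * (vt x M * (p / T))); last by rewrite e1 mulr1.
by field; rewrite T0.
Qed.

Lemma jacobi_pair_spectrum : exists y : nat -> R,
  [/\ forall i j, (i < j <= M)%N -> y j < y i,
      P M.+1 = \prod_(i < M.+1) ('X - (y i)%:P),
      forall j, (j <= M)%N -> 0 < (-1) ^+ j * vt (y j) M &
      forall i j : 'I_M.+1, \sum_(k < M.+1)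
        (Num.sqrt `|vt (y i) M| * v (y i) k) * (Num.sqrt `|vt (y j) M| * v (y j) k)
          * jac_weight k =
        if i == j then \prod_(l < M.+1 | l != j) `|y j - y l| else 0].
Proof.
have [y [ydec Py ysgn]] := three_term_roots R M b l P P0 l0 PS l_gt0 M (leqnn M).
have y_root j : (j <= M)%N -> root (P M.+1) (y j).
  rewrite -ltnS => jM; rewrite Py /root horner_prod (bigD1 (Ordinal jM)) //=.
  by rewrite hornerXsubC subrr mul0r.
exists y; split=> // [j jM|i j].
  (* Interlacing gives the sign of [(P M).[y j]], hence of [v (y j) M]; inversion preserves it. *)
  have -> : vt (y j) M = (v (y j) M)^-1.
    by rewrite -(mulr1_eq (jac_vec_endpoints _ (y_root j jM))) invrK.
  rewrite jac_vec_last -[(-1) ^+ j]invr_sign -invfM invr_gt0 mulrA.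
  apply: divr_gt0; first exact: ysgn.
  by rewrite big_nat_cond; apply: prodr_gt0 => i; rewrite andbT; apply: t_gt0.
have iM : (i <= M)%N by rewrite -ltnS.
have jM : (j <= M)%N by rewrite -ltnS.
transitivity (Num.sqrt `|vt (y i) M| * Num.sqrt `|vt (y j) M| *
    \sum_(k < M.+1) v (y i) k * v (y j) k * jac_weight k).
  by rewrite mulr_sumr; apply: eq_bigr => k _; ring.
case: eqVneq => [->|ij].
  rewrite -expr2 sqr_sqrtr // jac_vec_norm ?y_root //.
  by rewrite Py deriv_prod_XsubC_root normr_prod.
rewrite jac_vec_orthogonal ?mulr0 ?y_root //.
have : (i : nat) != j by [].
by rewrite neq_ltn => /orP[] lt_ij; [rewrite gt_eqF|rewrite lt_eqF] => //;
  apply: ydec; rewrite lt_ij.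
Qed.

End JacobiPair.

(** * Theta functions *)

Section InfiniteProducts.
Variables (R : realType) (p : R).
Hypotheses (p_gt0 : 0 < p) (p_lt1 : p < 1).

Lemma ler_prod_nat (f g : nat -> R) m n :
  (forall i, (m <= i < n)%N -> 0 <= f i <= g i) ->
  \prod_(m <= i < n) f i <= \prod_(m <= i < n) g i.
Proof.
move=> fg; rewrite big_nat_cond [leRHS]big_nat_cond; apply: ler_prod => i.
by rewrite andbT; apply: fg.
Qed.

Lemma infprod_partialE (f : nat -> R) N : (forall n, (0 < n)%N -> 0 < f n) ->
  \prod_(1 <= n < N.+1) f n = expR (series (fun n => ln (f n.+1)) N).
Proof.
move=> f_gt0; rewrite /series /= expR_sum big_add1 /=.
by apply: eq_big_nat => n _; rewrite lnK // posrE f_gt0.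
Qed.

(** The series of logarithms is dominated by a geometric one; the limit is the exponential of its
    sum, hence positive. *)
Lemma infprod_cvg (f : nat -> R) K : (forall n, (0 < n)%N -> 0 < f n) ->
  (forall n, (0 < n)%N -> `|ln (f n)| <= K * p ^+ n) ->
  exists2 L : R, 0 < L & (\prod_(1 <= n < N.+1) f n @[N --> \oo] --> L)%classic.
Proof.
move=> f_gt0 lnf.
pose s := (fun n => ln (f n.+1)) : R^nat.
have K0 : 0 <= K.
  by rewrite -(pmulr_lge0 _ (exprn_gt0 1 p_gt0)); apply: le_trans (lnf 1%N isT).
have s_cvg : cvgn (series s).
  apply: normed_cvg; apply: (@series_le_cvg _ _ (geometric (K * p) p)) => [n|n|n|].
  - exact: normr_ge0.
  - by rewrite /geometric /= !mulr_ge0 ?exprn_ge0 // ltW.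
  - by rewrite /geometric /= -mulrA -exprS lnf.
  - by apply: is_cvg_geometric_series; rewrite ger0_norm // ltW.
exists (expR (limn (series s))); first exact: expR_gt0.
under eq_fun => N do rewrite infprod_partialE //.
rewrite -/s; apply: continuous_cvg => //; exact: continuous_expR.
Qed.

Lemma infprodE (f : nat -> R) (L : R) :
  (\prod_(1 <= n < N.+1) f n @[N --> \oo] --> L)%classic -> infprod f = L.
Proof. by move=> fL; apply/cvg_lim. Qed.

Definition log_geometric K (f : nat -> R) :=
  forall n, (0 < n)%N -> 0 < f n /\ `|ln (f n)| <= K * p ^+ n.

Lemma infprod_gt0 f K : log_geometric K f -> 0 < infprod f.
Proof.
move=> h; have [L L0 fL] := infprod_cvg f K (fun n n0 => (h n n0).1) (fun n n0 => (h n n0).2).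
by rewrite (infprodE f L).
Qed.

(** Multiplying the factorwise bounds adds up the exponents, and [p / (1 - p)] is the sum of
    [p ^+ n] over n >= 1. *)
Lemma infprod_ratio f g K d : log_geometric K f -> log_geometric K g -> 0 <= d ->
  (forall n, (0 < n)%N -> f n <= g n <= f n * expR (d * p ^+ n)) ->
  infprod f <= infprod g <= infprod f * expR (d * (p / (1 - p))).
Proof.
move=> hf hg d0 fg.
have [Lf Lf0 cf] := infprod_cvg f K (fun n n0 => (hf n n0).1) (fun n n0 => (hf n n0).2).
have [Lg Lg0 cg] := infprod_cvg g K (fun n n0 => (hg n n0).1) (fun n n0 => (hg n n0).2).
rewrite (infprodE f Lf) // (infprodE g Lg) //.
have prod_gt0 N : 0 < \prod_(1 <= n < N.+1) f n.
  rewrite big_nat_cond; apply: prodr_gt0 => i; rewrite andbT => /andP[i0 _].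
  by have [] := hf i i0.
apply/andP; split.
  apply: (@ler_cvg_to _ _ _ _ _ _ _ _ cf cg); apply: nearW => N.
  apply: ler_prod_nat => n /andP[n0 _]; have /andP[-> _] := fg n n0.
  by rewrite andbT ltW //; case: (hf n n0).
apply: (@ler_cvg_to _ _ _ _ _
  (fun N => \prod_(1 <= n < N.+1) f n * expR (d * (p / (1 - p)))) _ _ cg).
  by apply: cvgM => //; exact: cvg_cst.
apply: nearW => N /=.
apply: (@le_trans _ _ (\prod_(1 <= n < N.+1) (f n * expR (d * p ^+ n)))).
  apply: ler_prod_nat => n /andP[n0 _]; have /andP[_ ->] := fg n n0.
  by rewrite andbT ltW //; case: (hg n n0).
rewrite big_split /= ler_wpM2l ?(ltW (prod_gt0 _)) // -expR_sum ler_expR.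
rewrite -mulr_sumr ler_wpM2l // big_add1 /=.
have := @geometric_seriesE R p p (negbT (lt_eqF p_lt1)) => /(congr1 (fun s => s N)) /=.
rewrite /series /= => E; under eq_bigr do rewrite exprS.
rewrite {}E ler_wpM2r ?invr_ge0 ?subr_ge0 ?(ltW p_lt1) //.
by rewrite ler_piMr ?(ltW p_gt0) // gerBl exprn_ge0 // ltW.
Qed.

End InfiniteProducts.

Section Theta.
Variables (R : realType) (p : R).
Hypotheses (p_gt0 : 0 < p) (p_lt1 : p < 1).

Lemma ln_le_abs (x T : R) : expR (- T) <= x <= expR T -> 0 < x /\ `|ln x| <= T.
Proof.
move=> /andP[x1 x2]; have x0 : 0 < x := lt_le_trans (expR_gt0 _) x1.
split=> //; rewrite ler_norml -(expRK (- T)) -[X in _ && (_ <= X)]expRK.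
by rewrite !ler_ln ?posrE ?expR_gt0 // x1.
Qed.

(** The factor lies between (1-P)^3 and (1+P)^2. Then 1+P <= exp(P) and 1-P >= exp(-P/(1-p)) bound
    its logarithm; the 3 is the exponent of the cube. *)
Lemma theta_factor_bound (P q r c : R) : 0 <= P <= p -> 0 <= q <= P -> 0 <= r <= P ->
  `|c| <= 1 ->
  let x := (1 - q) * (1 + 2 * r * c + r ^+ 2) in
  0 < x /\ `|ln x| <= 3 / (1 - p) * P.
Proof.
move=> /andP[P0 Pp] /andP[q0 qP] /andP[r0 rP] c1 x.
move: c1; rewrite ler_norml => /andP[c1 c2].
have p1 : 0 < 1 - p by rewrite subr_gt0.
have rc : - r <= r * c <= r by apply/andP; split; nra.
have x_ge : (1 - P) ^+ 3 <= x.
  have h1 : (1 - P) ^+ 2 <= 1 + 2 * r * c + r ^+ 2 by move: rc => /andP[? ?]; nra.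
  rewrite /x exprS; apply: ler_pM => //; [lra|exact: sqr_ge0|lra].
have x_le : x <= (1 + P) ^+ 2.
  have h1 : 1 + 2 * r * c + r ^+ 2 <= (1 + P) ^+ 2 by move: rc => /andP[? ?]; nra.
  rewrite /x -[leRHS]mul1r; apply: ler_pM => //; [lra| |lra].
  by move: rc => /andP[? ?]; nra.
have tP : P <= P / (1 - p) by rewrite ler_pdivlMr //; nra.
have -> : 3 / (1 - p) * P = 3%:R * (P / (1 - p)) by ring.
apply: ln_le_abs; apply/andP; split.
  apply: le_trans x_ge; rewrite -mulrN expRM_natl.
  apply: lerXn2r; rewrite ?nnegrE ?expR_ge0 //; first lra.
  rewrite expRN -[leRHS]invrK lef_pV2 ?posrE ?expR_gt0 ?invr_gt0 //; last lra.
  apply: le_trans (expR_ge1Dx _).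
  rewrite -div1r ler_pdivrMr; last lra.
  have h : (P / (1 - p)) * (1 - p) = P by rewrite divfK // gt_eqF.
  move: tP h; set t := P / (1 - p) => tP h; nra.
apply: le_trans x_le _; apply: (@le_trans _ _ (expR (2%:R * P))).
  by rewrite expRM_natl; apply: lerXn2r; rewrite ?nnegrE ?expR_ge0 ?expR_ge1Dx //; lra.
rewrite ler_expR; lra.
Qed.

Lemma exprn_anti n m : (n <= m)%N -> p ^+ m <= p ^+ n.
Proof. by move=> nm; apply: ler_wiXn2l => //; apply: ltW. Qed.

Lemma log_geometric_theta (e : nat -> nat) (c : R) : (forall n, (0 < n)%N -> (n <= e n)%N) ->
  `|c| <= 1 ->
  log_geometric R p (3 / (1 - p))
    (fun n => (1 - p ^+ (2 * n)) * (1 + 2 * p ^+ e n * c + (p ^+ e n) ^+ 2)).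
Proof.
move=> en c1 n n0; apply: theta_factor_bound => //; rewrite exprn_ge0 ?(ltW p_gt0) //=.
- by rewrite -[leRHS]expr1; apply: exprn_anti.
- by apply: exprn_anti; lia.
- by apply: exprn_anti; apply: en.
Qed.

Lemma abs_cos_le1 (x : R) : `|cos x| <= 1.
Proof. by rewrite ler_norml cos_geN1 cos_le1. Qed.

Definition theta1_prod (z : R) := infprod (fun n => (1 - p ^+ (2 * n)) *
  (1 - 2 * p ^+ (2 * n) * cos (2 * z) + p ^+ (4 * n))).

Lemma theta1_factorE (c : R) n :
  (1 - p ^+ (2 * n)) * (1 - 2 * p ^+ (2 * n) * c + p ^+ (4 * n)) =
  (1 - p ^+ (2 * n)) * (1 + 2 * p ^+ (2 * n) * (- c) + (p ^+ (2 * n)) ^+ 2).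
Proof. by rewrite -exprM mulnAC mulrN. Qed.

Lemma log_geometric_theta1 z : log_geometric R p (3 / (1 - p)) (fun n => (1 - p ^+ (2 * n)) *
  (1 - 2 * p ^+ (2 * n) * cos (2 * z) + p ^+ (4 * n))).
Proof.
move=> n n0; rewrite theta1_factorE.
by apply: (log_geometric_theta (fun n => 2 * n)%N) => // [m _|]; [lia|rewrite normrN abs_cos_le1].
Qed.

Lemma theta1_prod_gt0 z : 0 < theta1_prod z.
Proof. exact: (infprod_gt0 _ _ p_gt0 p_lt1 _ _ (log_geometric_theta1 z)). Qed.

Lemma theta1E z : theta1 p z = 2 * p `^ (4^-1) * sin z * theta1_prod z.
Proof. by []. Qed.

(** The reflection turns sine into cosine and changes the sign of cos 2z. Positivity thus passes
    from theta_1 to theta_2, and likewise from theta_3 to theta_4. *)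
Lemma theta1_shift z : theta1 p (pi / 2 - z) = theta2 p z.
Proof.
rewrite /theta1 /theta2; congr (_ * _ * _).
  by rewrite -opprB sinN sinBpihalf opprK.
congr infprod; apply/funext => n.
have -> : 2 * (pi / 2 - z) = - (2 * z) + pi by field.
by rewrite cosDpi cosN mulrN opprK.
Qed.

Lemma theta2_shift z : theta2 p (pi / 2 - z) = theta1 p z.
Proof. by rewrite -theta1_shift; congr (theta1 p _); ring. Qed.

Lemma theta3_shift z : theta3 p (pi / 2 - z) = theta4 p z.
Proof.
congr infprod; apply/funext => n.
have -> : 2 * (pi / 2 - z) = - (2 * z) + pi by field.
by rewrite cosDpi cosN mulrN.
Qed.

Lemma theta4_shift z : theta4 p (pi / 2 - z) = theta3 p z.
Proof. by rewrite -theta3_shift; congr (theta3 p _); ring. Qed.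

Lemma theta3_gt0 z : 0 < theta3 p z.
Proof.
apply: (infprod_gt0 _ _ p_gt0 p_lt1 _ (3 / (1 - p))) => n n0.
have -> : p ^+ (4 * n - 2) = (p ^+ (2 * n - 1)) ^+ 2 by rewrite -exprM; congr (_ ^+ _); lia.
by apply: (log_geometric_theta (fun n => 2 * n - 1)%N) => // [m|]; [lia|rewrite abs_cos_le1].
Qed.

Lemma theta4_gt0 z : 0 < theta4 p z.
Proof. by rewrite -theta3_shift theta3_gt0. Qed.

Lemma theta1_gt0 z : 0 < z < pi -> 0 < theta1 p z.
Proof.
move=> z_pi; rewrite theta1E mulr_gt0 ?theta1_prod_gt0 // !mulr_gt0 ?powR_gt0 //.
exact: sin_gt0_pi.
Qed.

Lemma theta2_gt0 z : - (pi / 2) < z < pi / 2 -> 0 < theta2 p z.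
Proof. by move=> /andP[z1 z2]; rewrite -theta1_shift theta1_gt0 //; lra. Qed.

Lemma theta1_0 : theta1 p 0 = 0.
Proof. by rewrite theta1E sin0 mulr0 mul0r. Qed.

(* Continuity of the product at 0 is what makes theta1'(0) nonzero, so that [ ]_1 is not
   junk (x / 0 = 0). *)
Lemma theta1_prod_squeeze z : theta1_prod 0 <= theta1_prod z <=
  theta1_prod 0 * expR (2 * (1 - cos (2 * z)) / (1 - p) ^+ 2 * (p / (1 - p))).
Proof.
have p1 : 0 < 1 - p by rewrite subr_gt0.
have cz : 0 <= 1 - cos (2 * z) by rewrite subr_ge0 cos_le1.
have d0 : 0 <= 2 * (1 - cos (2 * z)) / (1 - p) ^+ 2.
  by rewrite !mulr_ge0 ?invr_ge0 ?sqr_ge0.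
apply: (infprod_ratio _ _ p_gt0 p_lt1 _ _ _ _ (log_geometric_theta1 0) (log_geometric_theta1 z) d0).
move=> n n0; rewrite !theta1_factorE mulr0 cos0.
have q0 : 0 <= p ^+ (2 * n) by rewrite exprn_ge0 ?ltW.
have qn : p ^+ (2 * n) <= p ^+ n by apply: exprn_anti; lia.
have np : p ^+ n <= p by rewrite -[leRHS]expr1; apply: exprn_anti.
move: q0 qn np; move: (p ^+ (2 * n)) (p ^+ n) (cos (2 * z)) cz d0 => q P c cz d0 q0 qP Pp.
have q1 : 0 < 1 - q by lra.
apply/andP; split; first by rewrite ler_pM2l //; nra.
rewrite -[leRHS]mulrA ler_pM2l //.
have s0 : 0 <= 1 + 2 * q * (- 1) + q ^+ 2.
  have -> : 1 + 2 * q * (- 1) + q ^+ 2 = (1 - q) ^+ 2 by ring.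
  exact: sqr_ge0.
(* After exp(x) >= 1+x it remains to show 2(1-c)q <= d(1-q)^2 P; as q <= P <= p, this dictates the
   denominator (1-p)^2 in [d]. *)
apply: le_trans (ler_wpM2l s0 (expR_ge1Dx _)).
move: d0; set d := 2 * (1 - c) / (1 - p) ^+ 2 => d0.
have dE : d * (1 - p) ^+ 2 = 2 * (1 - c) by rewrite /d divfK // expf_neq0 ?gt_eqF.
have h1 : 2 * (1 - c) <= d * (1 - q) ^+ 2.
  rewrite -dE ler_wpM2l //; apply: lerXn2r; rewrite ?nnegrE; lra.
have h2 : 2 * (1 - c) * q <= d * (1 - q) ^+ 2 * P.
  by apply: ler_pM => //; rewrite mulr_ge0.
nra.
Qed.

(** The difference quotient is a constant times sin(h)/h times the product at [h], and the squeeze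
    makes the product continuous at 0. *)
Lemma derive1_theta1_0 : derive1 (theta1 p) 0 = 2 * p `^ (4^-1) * theta1_prod 0.
Proof.
have sin_cvg : (h^-1 * sin h @[h --> (0 : R)^'] --> (1 : R))%classic.
  have [sin_der sin_val] := @is_derive_sin R 0.
  have : (h^-1 *: (sin (h *: 1 + 0) - sin 0) @[h --> (0 : R)^'] --> 'D_1 sin (0 : R))%classic.
    exact: sin_der.
  rewrite sin_val cos0; under eq_fun => h do rewrite sin0 subr0 addr0.
  by under eq_fun => h do rewrite -[h *: 1]/(h * 1) mulr1.
have cos_cvg : (cos (2 * h) @[h --> (0 : R)^'] --> (1 : R))%classic.
  suff : (cos (2 * h) @[h --> (0 : R)^'] --> cos (2 * 0 : R))%classic by rewrite mulr0 cos0.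
  apply: continuous_cvg; first exact: continuous_cos.
  by apply: cvgM; [exact: cvg_cst|exact: cvg_within].
have prod_cvg : (theta1_prod h @[h --> (0 : R)^'] --> theta1_prod 0)%classic.
  apply: (squeeze_cvgr (f := fun=> theta1_prod 0) (h := fun z => theta1_prod 0 *
    expR (2 * (1 - cos (2 * z)) / (1 - p) ^+ 2 * (p / (1 - p))))).
  - by apply: nearW => h; exact: theta1_prod_squeeze.
  - exact: cvg_cst.
  - suff : (theta1_prod 0 * expR (2 * (1 - cos (2 * z)) / (1 - p) ^+ 2 * (p / (1 - p)))
        @[z --> (0 : R)^'] -->
        theta1_prod 0 * expR (2 * (1 - 1) / (1 - p) ^+ 2 * (p / (1 - p))))%classic.
      by rewrite subrr mulr0 !mul0r expR0 mulr1.
    apply: cvgM; first exact: cvg_cst.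
    apply: continuous_cvg; first exact: continuous_expR.
    apply: cvgM; last exact: cvg_cst.
    apply: cvgM; last exact: cvg_cst.
    apply: cvgM; first exact: cvg_cst.
    by apply: cvgB => //; exact: cvg_cst.
apply/cvg_lim => //.
have -> : (fun h : R => h^-1 *: (theta1 p (h + 0) - theta1 p 0)) =
    (fun h => 2 * p `^ (4^-1) * (h^-1 * sin h * theta1_prod h)).
  apply/funext => h; rewrite theta1_0 subr0 addr0 theta1E -[_ *: _]/(_ * _); ring.
apply: cvgM; first exact: cvg_cst.
by rewrite -[X in (_ --> X)%classic]mul1r; apply: cvgM.
Qed.

Lemma derive1_theta1_0_gt0 : 0 < derive1 (theta1 p) 0.
Proof. by rewrite derive1_theta1_0 !mulr_gt0 ?powR_gt0 ?theta1_prod_gt0. Qed.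

End Theta.

(** * Brackets and coefficients *)

Lemma ord4P (Pr : 'I_4 -> Prop) :
  Pr ord0 -> Pr (inord 1) -> Pr (inord 2) -> Pr (inord 3) -> forall r, Pr r.
Proof.
move=> p0 p1 p2 p3 [[|[|[|[|//]]]] i4].
- by have -> : Ordinal i4 = ord0 by apply: val_inj.
- by have -> : Ordinal i4 = inord 1 by apply: val_inj; rewrite /= inordK.
- by have -> : Ordinal i4 = inord 2 by apply: val_inj; rewrite /= inordK.
- by have -> : Ordinal i4 = inord 3 by apply: val_inj; rewrite /= inordK.
Qed.

Local Notation swap := (piperm (inord 1)).

(** The four permutations form a Klein four-group; this makes tilde c_r equal to c with index
    [swap r]. *)
Lemma piperm_swap r s : piperm (swap r) s = swap (piperm r s).
Proof.
by move: r s; do 2 elim/ord4P; apply: val_inj; rewrite /piperm /= ?inordK //= ?inordK.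
Qed.

Lemma swapK : involutive swap.
Proof. by elim/ord4P; apply: val_inj; rewrite /piperm /= ?inordK //= ?inordK. Qed.

Lemma swap0 : swap ord0 = inord 1.
Proof. by apply: val_inj; rewrite /piperm /= ?inordK. Qed.

Lemma swap1 : swap (inord 1) = ord0.
Proof. by have := swapK ord0; rewrite swap0. Qed.

Section Tilde.
Variables (R : realType) (u : 'I_4 -> R).

Lemma tildePK : tildeP (tildeP u) = u.
Proof. by apply/funext => s; rewrite /tildeP swapK. Qed.

Lemma tildeP0 : tildeP u ord0 = u (inord 1).
Proof. by rewrite /tildeP swap0. Qed.

Lemma tildeP1 : tildeP u (inord 1) = u ord0.
Proof. by rewrite /tildeP swap1. Qed.

Lemma alpha_of_tildeP M : alpha_of (tildeP u) M = alpha_of u M.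
Proof. by rewrite /alpha_of tildeP0 tildeP1 [u (inord 1) + _]addrC. Qed.

End Tilde.

Section Bracket.
Variables (R : realType) (p S : R).
Hypotheses (p_gt0 : 0 < p) (p_lt1 : p < 1) (S_gt0 : 0 < S).

Let br := br p (pi / S).

Let alpha_gt0 : 0 < pi / S / 2.
Proof. by rewrite !divr_gt0 ?pi_gt0. Qed.

Let alphaS : pi / S / 2 * S = pi / 2.
Proof. by field; rewrite gt_eqF. Qed.

Lemma br_zero : br ord0 0 = 0.
Proof. by rewrite /br /Defs.br /= mulr0 theta1_0 mul0r. Qed.

(** Here alpha/2 times [S] is pi/2, so the interval ends are rescaled zeros of sine and cosine. The
    last two brackets are positive everywhere. *)
Lemma br_gt0 (r : 'I_4) z : (r = ord0 -> 0 < z < 2 * S) -> (r = inord 1 -> - S < z < S) ->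
  0 < br r z.
Proof.
elim/ord4P: r => r0 r1; rewrite /br /Defs.br /= ?inordK //.
- have /andP[z0 zS] := r0 erefl; apply: divr_gt0; last first.
    by rewrite mulr_gt0 ?derive1_theta1_0_gt0.
  apply: theta1_gt0 => //; rewrite mulr_gt0 //=.
  rewrite [ltRHS](_ : _ = pi / S / 2 * (2 * S)); last by field; rewrite gt_eqF.
  by rewrite ltr_pM2l.
- have /andP[zl zS] := r1 erefl; apply: divr_gt0; last first.
    by apply: theta2_gt0 => //; rewrite oppr_lt0 divr_gt0 ?pi_gt0.
  by apply: theta2_gt0 => //; rewrite -alphaS -mulrN !ltr_pM2l // zl.
- by rewrite divr_gt0 ?theta3_gt0.
- by rewrite divr_gt0 ?theta4_gt0.
Qed.

(** The quarter-period reflection of the thetas; [k r] is a quotient of the normalising denominators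
    of two brackets. *)
Lemma br_shift : exists2 k : 'I_4 -> R, forall r, k r != 0 &
  forall r z, br r (S - z) = k r * br (swap r) z.
Proof.
have t2 : 0 < theta2 p 0 by apply: theta2_gt0 => //; rewrite oppr_lt0 divr_gt0 ?pi_gt0.
have t3 := theta3_gt0 _ _ p_gt0 p_lt1 0; have t4 := theta4_gt0 _ _ p_gt0 p_lt1 0.
have t1 : 0 < pi / S / 2 * derive1 (theta1 p) 0 by rewrite mulr_gt0 ?derive1_theta1_0_gt0.
pose t r := match val (r : 'I_4) with
  | 0%N => pi / S / 2 * derive1 (theta1 p) 0
  | 1%N => theta2 p 0 | 2%N => theta3 p 0 | _ => theta4 p 0 end.
have t_gt0 r : 0 < t r by elim/ord4P: r; rewrite /t /= ?inordK.
exists (fun r => t (swap r) / t r) => [r|r z].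
  by rewrite gt_eqF // divr_gt0.
have shift : pi / S / 2 * (S - z) = pi / 2 - pi / S / 2 * z by rewrite mulrBr alphaS.
have : 0 < t (swap r) by []; have : 0 < t r by [].
elim/ord4P: r; rewrite /t /br /Defs.br /piperm /= ?inordK //= ?inordK //= shift
  ?theta1_shift ?theta2_shift ?theta3_shift ?theta4_shift => h1 h2;
  by rewrite [RHS]mulrC [RHS]mulrA divfK // gt_eqF.
Qed.

End Bracket.

Section Coefficients.
Variables (R : realType) (p : R) (u v : 'I_4 -> R) (M : nat) (uu : R).
Hypotheses (p_gt0 : 0 < p) (p_lt1 : p < 1) (u0_gt0 : 0 < u ord0) (u1_gt0 : 0 < u (inord 1)).

Let S := u ord0 + u (inord 1) + M%:R.

Let S_gt0 : 0 < S. Proof. by rewrite ltr_wpDr ?ler0n // addr_gt0. Qed.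

Lemma a_coef0 : a_coef p u v M 0 = 0.
Proof.
by rewrite /a_coef (bigD1 ord0) //= subrr addr0 br_zero !mul0r.
Qed.

(** The bounds on the parameters place all arguments for the first two brackets in the positivity
    intervals; k >= 1 offsets the bound u_1 - v_1 - 1/2 > -1. *)
Lemma a_coef_gt0 k : `|v ord0| < u ord0 + 2^-1 -> `|v (inord 1)| < u (inord 1) + 2^-1 ->
  (0 < k <= M)%N -> 0 < a_coef p u v M k.
Proof.
move=> v0 v1 /andP[k0 kM].
have {}k0 : 1 <= k%:R :> R by rewrite ler1n.
have {}kM : k%:R <= M%:R :> R by rewrite ler_nat.
move: v0 v1; rewrite !ltr_norml => /andP[v0 v0'] /andP[v1 v1'].
have u0_pos : 0 < u ord0 := u0_gt0; have u1_pos : 0 < u (inord 1) := u1_gt0.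
apply: prodr_gt0 => r _; apply: divr_gt0; apply: mulr_gt0;
  by apply: br_gt0 => // rE; rewrite ?rE -/S /S; apply/andP; split; lra.
Qed.

(** Reindexing by [swap] matches the coefficients c_r. The reflection S - z matches the brackets,
    and its constants cancel within each quotient. *)
Lemma b_coef_tilde k : (k <= M)%N ->
  b_coef p (tildeP u) (tildeP v) M uu k = b_coef p u v M uu (M - k).
Proof.
move=> kM; rewrite /b_coef alpha_of_tildeP /alpha_of -/S.
have [c c0 cP] := br_shift _ _ _ p_gt0 p_lt1 S_gt0.
rewrite [RHS](reindex_inj (inv_inj swapK)) /=.
apply: eq_bigr => r _; congr (_ * _).
  rewrite /c_coef alpha_of_tildeP; congr (_ * _); apply: eq_bigr => s _.
  by rewrite /tildeP piperm_swap.
rewrite tildeP0 natrB //.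
have -> : u (inord 1) + k%:R + 2^-1 + uu = S - (u ord0 + (M%:R - k%:R) - 2^-1 - uu)
  by rewrite /S; ring.
have -> : u (inord 1) + k%:R - 2^-1 - uu = S - (u ord0 + (M%:R - k%:R) + 2^-1 + uu)
  by rewrite /S; ring.
have -> : u (inord 1) + k%:R + 2^-1 = S - (u ord0 + (M%:R - k%:R) - 2^-1) by rewrite /S; ring.
have -> : u (inord 1) + k%:R - 2^-1 = S - (u ord0 + (M%:R - k%:R) + 2^-1) by rewrite /S; ring.
rewrite !cP mulrACA [X in _ / X]mulrACA -mulf_div divff ?mulf_neq0 // mul1r.
by congr (_ / _); rewrite mulrC.
Qed.

End Coefficients.

(** * The recurrences for p_k and tilde p_k *)

Section Pk.
Variables (R : realType) (p : R) (u v : 'I_4 -> R) (M : nat) (uu : R).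

Let a := a_coef p u v M.
Let t := at_coef p u v M.
Let b := b_coef p u v M uu.

Lemma HmatE : Hmat p u v M uu = jacobi_mx M b a t.
Proof. by []. Qed.

(** Indexed by [nat], so that the leading minors of all sizes come from one function. *)
Definition tridiag_entry (i j : nat) : {poly R} :=
  if i == j then 'X - (b i)%:P
  else if i == j.+1 then - (a i)%:P
  else if j == i.+1 then - (t (M - i)%N)%:P
  else 0.

Lemma pkE k : (k <= M.+1)%N ->
  pk p u v M uu k = \det (\matrix_(i < k, j < k) tridiag_entry i j).
Proof.
move=> kM; congr (\det _); apply/matrixP => i j.
rewrite !mxE -(inj_eq val_inj) /= !inordK ?(leq_trans (ltn_ord _) kM) //.
rewrite /tridiag_entry; case: eqP => _; first by rewrite mulr1n.
by rewrite mulr0n sub0r; case: eqP => _ //; case: eqP => _ //; rewrite oppr0.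
Qed.

Lemma pk0 : pk p u v M uu 0 = 1.
Proof. exact: det_mx00. Qed.

Lemma pkS k : a 0%N = 0 -> (k <= M)%N ->
  pk p u v M uu k.+1 = ('X - (b k)%:P) * pk p u v M uu k
    - (a k * t (M.+1 - k)%N) *: pk p u v M uu k.-1.
Proof.
move=> a0; case: k => [|k] kM.
  by rewrite pk0 pkE // det_mx11 mxE /tridiag_entry eqxx a0 mul0r scale0r subr0 mulr1.
rewrite (pkE k.+2) // (pkE k.+1 (leqW kM)) (pkE k (leqW (ltnW kM))).
rewrite det_tridiag => [|i j ij]; last first.
  by rewrite /tridiag_entry; do 3 (case: ifP => [/eqP e|_]; first by exfalso; lia).
rewrite /tridiag_entry !eqxx /= gtn_eqF // ltn_eqF // (ltn_eqF (leqnSn k.+1)) subSS.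
by rewrite mulrNN -polyCM -mul_polyC.
Qed.

Lemma pk_char_poly : pk p u v M uu M.+1 = char_poly (Hmat p u v M uu).
Proof. by congr (\det _); apply/matrixP => i j; rewrite !mxE !inord_val. Qed.

End Pk.

Section Pkt.
Variables (R : realType) (p : R) (u v : 'I_4 -> R) (M : nat) (uu : R).
Hypotheses (p_gt0 : 0 < p) (p_lt1 : p < 1) (u0_gt0 : 0 < u ord0) (u1_gt0 : 0 < u (inord 1)).

Let a := a_coef p u v M.
Let t := at_coef p u v M.
Let b := b_coef p u v M uu.

Lemma at_coef_tildeP k : at_coef p (tildeP u) (tildeP v) M k = a k.
Proof. by rewrite /at_coef !tildePK. Qed.

Lemma pktS k : (k <= M)%N ->
  pkt p u v M uu k.+1 = ('X - (b (M - k)%N)%:P) * pkt p u v M uu k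
    - (t k * a (M.+1 - k)%N) *: pkt p u v M uu k.-1.
Proof.
move=> kM; rewrite /pkt pkS ?a_coef0 // b_coef_tilde //.
by rewrite at_coef_tildeP.
Qed.

(** The tilde matrix is [Hmat] with rows and columns reversed, so the characteristic polynomials
    agree; this is the source of tilde e_j = e_j. *)
Lemma pkt_pk : pk p u v M uu M.+1 = pkt p u v M uu M.+1.
Proof.
rewrite /pkt !pk_char_poly /char_poly -[LHS]det_ord_rev; congr (\det _).
apply/matrixP => i j.
rewrite [LHS]mxE.
rewrite /char_poly_mx [LHS]mxE [RHS]mxE.
rewrite [X in X + _]mxE.
rewrite [X in _ = X + _]mxE.
rewrite (inj_eq rev_ord_inj).
congr (_ + _).
rewrite [LHS]mxE [RHS]mxE; congr (- _); rewrite [LHS]mxE [RHS]mxE; congr (_%:P).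
rewrite [LHS]mxE [RHS]mxE.
rewrite (inj_eq rev_ord_inj) -!(inj_eq val_inj) /=.
have := ltn_ord i; have := ltn_ord j; rewrite !ltnS => jM iM.
rewrite !subSS b_coef_tilde // at_coef_tildeP.
case: ifP => // ij.
have -> : (M - i == (M - j).+1)%N = ((j : nat) == i.+1) by lia.
have -> : (M - j == (M - i).+1)%N = ((i : nat) == j.+1) by lia.
case: (eqVneq (j : nat) i.+1) => [ji|].
  by rewrite ltn_eqF ?ji //.
by case: ifP => // _ _; rewrite subKn.
Qed.

End Pkt.

(** * The vectors h_k as normalised Jacobi eigenvectors *)

Section HeunBasis.
Variables (R : realType) (p : R) (u v : 'I_4 -> R) (M : nat) (uu : R).

Lemma hkE k x : hk p u v M uu k x =
  Num.sqrt `|eps p u v M uu x| * jac_vec R M (at_coef p u v M) (pk p u v M uu) x k.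
Proof. by rewrite /hk /jac_vec mulrA. Qed.

End HeunBasis.

(** The tilde operation is an involution, so tilde epsilon contains p_m itself. *)
Lemma hk_tildeE (R : realType) (p : R) (u v : 'I_4 -> R) M (uu : R) k (x : R) :
  hk p (tildeP u) (tildeP v) M uu k x =
  Num.sqrt `|(pk p u v M uu M).[x] / \prod_(1 <= n < M.+1) at_coef p u v M n| *
  jac_vec R M (a_coef p u v M) (pkt p u v M uu) x k.
Proof.
rewrite hkE /eps /pkt !tildePK; congr (_ * _); rewrite /jac_vec.
by congr (_ * _); apply: eq_bigr => i _; rewrite at_coef_tildeP.
Qed.

(** With r the root of |e|, [e] is (-1)^j r^2 and the left side is (-1)^j r: the origin of the sign
    in the palindromic symmetry. *)
Lemma sqrt_norm_inv_mul {R : rcfType} j (e : R) : 0 < (-1) ^+ j * e ->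
  Num.sqrt `|e^-1| * e = (-1) ^+ j * Num.sqrt `|e|.
Proof.
move=> se; have ne : `|e| = (-1) ^+ j * e by rewrite -(normrMsign j) gtr0_norm.
have r_gt0 : 0 < Num.sqrt `|e| by rewrite sqrtr_gt0 ne.
have eE : e = (-1) ^+ j * Num.sqrt `|e| ^+ 2.
  by rewrite sqr_sqrtr // ne mulrA -expr2 sqrr_sign mul1r.
rewrite normfV sqrtrV // {2}eE expr2 mulrCA; congr (_ * _).
by rewrite mulKf // gt_eqF.
Qed.

Theorem mainTheorem9 (R : realType) (p : R) (u v : 'I_4 -> R) (M : nat) (uu : R)
  (hp0 : 0 < p) (hp1 : p < 1)
  (hu1 : 0 < u ord0) (hu2 : 0 < u (inord 1))
  (hv1 : `|v ord0| < u ord0 + 2^-1) (hv2 : `|v (inord 1)| < u (inord 1) + 2^-1)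
  (huu : forall z : int, uu != 2 * pi / alpha_of u M * z%:~R)
  (huu1 : forall z : int, uu + 1 != 2 * pi / alpha_of u M * z%:~R) :
  exists E : 'I_M.+1 -> R,
    (* E_0 > E_1 > ... > E_M are the roots of p_{M+1} *)
    (forall i j : 'I_M.+1, (i < j)%N -> E j < E i) /\
    (forall x : R, root (pk p u v M uu M.+1) x <-> exists j, x = E j) /\
    (* (i) nontrivial complex solutions only for E in {E_0, ..., E_M} *)
    (forall (e : R[i]) (h : 'cV[R[i]]_M.+1),
        map_mx (real_complex R) (Hmat p u v M uu) *m h = e *: h ->
        h != 0 -> exists j, e = ((E j)%:C)%C) /\
    (* (ii) explicit solution and the formula for h_0 *)
    (forall j : 'I_M.+1,
        Hmat p u v M uu *m (\col_(k < M.+1) hk p u v M uu k (E j))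
          = E j *: (\col_(k < M.+1) hk p u v M uu k (E j)) /\
        Num.sqrt `|eps p u v M uu (E j)|
          = Num.sqrt `|(\prod_(1 <= n < M.+1) at_coef p u v M n)
                        / (pk p u v M uu M).[E j]|) /\
    (* (iii) palindromic quasi-symmetry: tilde E_j = E_j and
       tilde h_k (tilde E_j) = (-1)^j h_{M-k}(E_j) *)
    (forall x : R,
        root (pkt p u v M uu M.+1) x <-> exists j, x = E j) /\
    (forall j k : 'I_M.+1,
        hk p (tildeP u) (tildeP v) M uu k (E j)
          = (-1) ^+ j * hk p u v M uu (M - k) (E j)) /\
    (* (iv) orthogonality relations *)
    (forall i j : 'I_M.+1,
        \sum_(k < M.+1) hk p u v M uu k (E i) * hk p u v M uu k (E j) * wk p u v M k
          = if i == j then \prod_(l < M.+1 | l != j) `|E j - E l| else 0) /\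
    (forall l k : 'I_M.+1,
        \sum_(j < M.+1) hk p u v M uu l (E j) * hk p u v M uu k (E j)
                        / \prod_(i < M.+1 | i != j) `|E j - E i|
          = if l == k then (wk p u v M k)^-1 else 0).
Proof.
(* Existential packing keeps the coefficients opaque, leaving only the data of a Jacobi pair. *)
have [a aE] := ex_intro (fun x => x = a_coef p u v M) _ erefl.
have [t tE] := ex_intro (fun x => x = at_coef p u v M) _ erefl.
have [b bE] := ex_intro (fun x => x = b_coef p u v M uu) _ erefl.
have [P PE] := ex_intro (fun x => x = pk p u v M uu) _ erefl.
have [Q QE] := ex_intro (fun x => x = pkt p u v M uu) _ erefl.
have a0 : a 0%N = 0 by rewrite aE; exact: a_coef0.
have t0 : t 0%N = 0 by rewrite tE; exact: a_coef0.
have a_gt0 k : (0 < k <= M)%N -> 0 < a k by rewrite aE; exact: a_coef_gt0.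
have t_gt0 k : (0 < k <= M)%N -> 0 < t k.
  by rewrite tE; apply: a_coef_gt0; rewrite ?tildeP0 ?tildeP1.
have t_neq0 k : (0 < k <= M)%N -> t k != 0 by move=> /t_gt0 /lt0r_neq0.
have P0 : P 0%N = 1 by rewrite PE; exact: pk0.
have Q0 : Q 0%N = 1 by rewrite QE; exact: pk0.
have PS k : (k <= M)%N ->
    P k.+1 = ('X - (b k)%:P) * P k - (a k * t (M.+1 - k)%N) *: P k.-1.
  by move=> kM; rewrite PE aE tE bE pkS // a_coef0.
have QS k : (k <= M)%N ->
    Q k.+1 = ('X - (b (M - k)%N)%:P) * Q k - (t k * a (M.+1 - k)%N) *: Q k.-1.
  by move=> kM; rewrite QE aE tE bE; exact: pktS.
have PQ : P M.+1 = Q M.+1 by rewrite PE QE; exact: pkt_pk.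
have HE : Hmat p u v M uu = jacobi_mx M b a t by rewrite aE tE bE; exact: HmatE.
have charE : char_poly (Hmat p u v M uu) = P M.+1 by rewrite PE pk_char_poly.
have epsE x : eps p u v M uu x = jac_vec R M a Q x M by rewrite aE QE jac_vec_tilde_last.
have VM x : jac_vec R M t P x M = (P M).[x] / \prod_(1 <= n < M.+1) t n by exact: jac_vec_last.
have hE k x : hk p u v M uu k x =
    Num.sqrt `|jac_vec R M a Q x M| * jac_vec R M t P x k.
  by rewrite hkE epsE PE tE.
have htE k x : hk p (tildeP u) (tildeP v) M uu k x =
    Num.sqrt `|jac_vec R M t P x M| * jac_vec R M a Q x k.
  by rewrite hk_tildeE VM PE tE QE aE.
have wE k : wk p u v M k = jac_weight R M a t k by rewrite aE tE.
rewrite -tE -PE -QE; clear aE tE bE PE QE huu huu1.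
have [y [ydec Py e_sgn orth]] :=
  jacobi_pair_spectrum R M b a t P Q a0 t0 a_gt0 t_gt0 P0 Q0 PS QS PQ.
have le_ord (j : 'I_M.+1) : (j <= M)%N by rewrite -ltnS.
have rootP x : root (P M.+1) x <-> exists j : 'I_M.+1, x = y j.
  rewrite Py -(big_map (fun i : 'I_M.+1 => y i) xpredT (fun x => 'X - x%:P)) root_prod_XsubC.
  split=> [/seq.mapP[j _ ->]|[j ->]]; first by exists j.
  by apply/seq.mapP; exists j; rewrite ?mem_index_enum.
have y_root (j : 'I_M.+1) : root (P M.+1) (y j) by apply/rootP; exists j.
have eV (j : 'I_M.+1) : jac_vec R M a Q (y j) M = (jac_vec R M t P (y j) M)^-1.
  have /mulr1_eq <- := jac_vec_endpoints R M b a t P Q a0 t0 a_gt0 t_gt0 P0 Q0 PS QS PQ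
    _ (y_root j).
  by rewrite invrK.
have {}orth (i j : 'I_M.+1) :
    \sum_(k < M.+1) hk p u v M uu k (y i) * hk p u v M uu k (y j) * wk p u v M k
      = if i == j then \prod_(l < M.+1 | l != j) `|y j - y l| else 0.
  by under eq_bigr => k _ do rewrite !hE wE; exact: orth.
exists (fun j : 'I_M.+1 => y j); split; [|split; [|split; [|split; [|split; [|split; [|split]]]]]].
- by move=> i j ij; apply: ydec; rewrite ij le_ord.
- exact: rootP.
(* The characteristic polynomial already splits over the reals, so every complex eigenvalue is some
   real [y j]. *)
- move=> c h Hh h0; have := eigenvector_root_char _ _ _ _ Hh h0.
  rewrite -map_char_poly charE Py rmorph_prod /=.
  under eq_bigr => i _ do rewrite map_polyXsubC.
  rewrite -(big_map (fun i : 'I_M.+1 => real_complex R (y i)) xpredT (fun x => 'X - x%:P)).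
  by rewrite root_prod_XsubC => /seq.mapP[j _ ->]; exists j.
- move=> j; split.
    apply/colP => k.
    rewrite HE (jacobi_mx_mulE _ _ _ _ (fun k => hk p u v M uu k (y j)) _ a0 t0).
    rewrite !mxE !hE !(mulrCA _ (Num.sqrt _)) -!mulrDr; congr (_ * _).
    by apply: (jac_vecP _ _ b a t P a0 t0 PS t_neq0); rewrite ?y_root ?le_ord.
  by rewrite epsE eV VM invf_div.
- by move=> x; rewrite -PQ.
- move=> j k; rewrite htE hE.
  rewrite (jac_vec_tilde_reversal _ _ b a t P Q a0 t0 a_gt0 t_gt0 P0 PS QS PQ) ?y_root ?le_ord //.
  rewrite mulrA [RHS]mulrA; congr (_ * _).
  (* The last entry is the inverse of epsilon_j, so |epsilon_j^-1|^(1/2) epsilon_j is to be compared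
     with |epsilon_j|^(1/2). *)
  rewrite -[jac_vec R M t P _ M]invrK -eV.
  by apply: sqrt_norm_inv_mul; apply: e_sgn; apply: le_ord.
- exact: orth.
- apply: (dual_orthogonality _ (fun i k : 'I_M.+1 => hk p u v M uu k (y i))
    (fun k => wk p u v M k) (fun j => \prod_(i < M.+1 | i != j) `|y j - y i|)).
  + by move=> k; rewrite wE gt_eqF // (jac_weight_gt0 _ _ _ _ a_gt0 t_gt0) ?le_ord.
  + move=> j; apply/prodf_neq0 => i; rewrite normr_eq0 subr_eq0 -(inj_eq val_inj) neq_ltn.
    by move=> /orP[] ij; [rewrite lt_eqF|rewrite gt_eqF]; rewrite ?ydec ?ij ?le_ord.
  + exact: orth.
Qed.
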